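(* For all integers $k\geq 3$, $f(k,2)\geq \frac{(k-1)(3k-4)}{2}$.
   Context: $S_n$ denotes the set of permutations of $\{1,2,\ldots,n\}$ written in one-line notation $p=(p_1,p_2,\ldots,p_n)$. A subsequence of $p$ of length $k$ is a sequence $(p_{i_1},\ldots,p_{i_k})$ with $i_1<\cdots<i_k$. A sequence $(a_1,a_2,\ldots,a_k)$ of positive integers is $2$-additive if $a_1+a_2+\cdots+a_k=2a_1$ or $a_1+a_2+\cdots+a_k=2a_k$. For $k\geq 3$, $f(k,2)$ denotes the smallest positive integer $n$ such that every $p\in S_n$ has a $2$-additive subsequence of length $k$ (such an $n$ exists for every $k\geq 3$). *)

(* Defs.v *)
From mathcomp Require Import all_boot all_fingroup.
From mathcomp Require Import zify.

Set Implicit Arguments.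
Unset Strict Implicit.
Unset Printing Implicit Defensive.

Definition two_additive (a : seq nat) : bool :=
  (sumn a == 2 * head 0 a) || (sumn a == 2 * last 0 a).

(* 'S_n permutes {0, ..., n-1}; positions and entries are shifted by one, so
   the entry of p at (0-based) position i, as an element of {1, ..., n}, is
   (p i).+1. *)
Definition entry (n : nat) (p : 'S_n) (i : 'I_n) : nat := (p i).+1.

Definition has_two_additive_subseq (k n : nat) (p : 'S_n) : bool :=
  [exists t : k.-tuple 'I_n,
     sorted (fun i j : 'I_n => i < j) t && two_additive (map (entry p) t)].

Definition unavoidable (k n : nat) : bool :=
  (0 < n) && [forall p : 'S_n, has_two_additive_subseq k p].

Lemma sort_lt n (U : seq 'I_n) :
  uniq U ->
  sorted (fun i j : 'I_n => i < j) (sort (fun i j : 'I_n => i <= j) U).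
Proof.
move=> uU; set s := sort _ U.
have -> : sorted (fun i j : 'I_n => i < j) s = sorted ltn (map (@nat_of_ord n) s).
  by rewrite sorted_map.
rewrite ltn_sorted_uniq_leq.
rewrite map_inj_uniq ?sort_uniq ?uU; last exact: val_inj.
by rewrite sorted_map; apply: sort_sorted => x y; apply: leq_total.
Qed.

Lemma has_left n (p : 'S_n) (U : seq 'I_n) (j : 'I_n) :
  uniq U -> all (fun i : 'I_n => i < j) U ->
  sumn (map (entry p) U) = entry p j ->
  has_two_additive_subseq (size U).+1 p.
Proof.
move=> uU lU sU; pose le := fun i j : 'I_n => i <= j.
have pU : perm_eq (sort le U) U by rewrite perm_sort.
have sz : size (rcons (sort le U) j) == (size U).+1.
  by rewrite size_rcons size_sort.
apply/existsP; exists (Tuple sz) => /=; apply/andP; split.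
  have lt_tr : transitive (fun i j : 'I_n => i < j) by move=> ? ? ?; apply: ltn_trans.
  rewrite (sorted_pairwise lt_tr) -cats1 pairwise_cat /= !andbT.
  apply/andP; split.
    by apply/allrelP => x y; rewrite mem_sort inE => xU /eqP ->; apply: (allP lU).
  rewrite -(sorted_pairwise lt_tr).
  exact: sort_lt.
rewrite /two_additive map_rcons sumn_rcons last_rcons.
rewrite (perm_sumn (perm_map _ pU)) sU; apply/orP; right; apply/eqP; lia.
Qed.

Lemma has_right n (p : 'S_n) (U : seq 'I_n) (j : 'I_n) :
  uniq U -> all (fun i : 'I_n => j < i) U ->
  sumn (map (entry p) U) = entry p j ->
  has_two_additive_subseq (size U).+1 p.
Proof.
move=> uU lU sU; pose le := fun i j : 'I_n => i <= j.
have pU : perm_eq (sort le U) U by rewrite perm_sort.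
have sz : size (j :: sort le U) == (size U).+1 by rewrite /= size_sort.
apply/existsP; exists (Tuple sz) => /=; apply/andP; split.
  have lt_tr : transitive (fun i j : 'I_n => i < j) by move=> ? ? ?; apply: ltn_trans.
  rewrite (path_sortedE lt_tr); apply/andP; split.
    by apply/allP => x; rewrite mem_sort => xU; apply: (allP lU).
  exact: sort_lt.
rewrite /two_additive /=.
rewrite (perm_sumn (perm_map _ pU)) sU; apply/orP; left; apply/eqP; lia.
Qed.

Lemma sumn_map_mul d s : sumn (map (muln d) s) = d * sumn s.
Proof. by elim: s => [|x s IH] /=; rewrite ?muln0 // IH mulnDr. Qed.

Lemma sumn_le K s : all (fun x => x <= K) s -> sumn s <= size s * K.
Proof. by elim: s => //= x s IH /andP[xK /IH h]; rewrite mulSn leq_add. Qed.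

Lemma sumn_ge s : all (fun x => 0 < x) s -> size s <= sumn s.
Proof. by elim: s => //= x s IH /andP[x0 /IH h]; lia. Qed.

Definition width M := (2 * M + M).+1 + sumn (iota (2 * M).+1 M).

(* If r is a strict total order on {1, ..., N} and A, consisting of small
   numbers, lies below a large multiple s of d = sumn A, then either some
   y <= s is the sum of A and y - d with y - d below y, or all multiples of d
   in (2M, s) lie above s, and M+1 of them add up to s. *)
Lemma descent (r : rel nat) N M (A : seq nat) T :
  transitive r ->
  (forall x y, 0 < x <= N -> 0 < y <= N -> x != y -> r x y || r y x) ->
  0 < M -> uniq A -> size A = M -> all (fun x => 0 < x <= 2 * M) A ->
  width M <= T -> sumn A * T <= N ->
  all (fun a => r a (sumn A * T)) A ->
  exists (V : seq nat) (s : nat),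
    [/\ uniq V, size V = M.+1, all (fun x => 0 < x <= N) (s :: V), sumn V = s &
        all (fun v => r v s) V \/ all (fun v => r s v) V].
Proof.
move=> rtr rtot M0 uA sA bA WT dN rA; set d := sumn A in dN rA *.
have d0 : 0 < d.
  apply: leq_trans (sumn_ge (s := A) _); first by rewrite sA.
  by apply/allP => x /(allP bA) /andP[].
pose good := exists (V : seq nat) (s : nat),
    [/\ uniq V, size V = M.+1, all (fun x => 0 < x <= N) (s :: V), sumn V = s &
        all (fun v => r v s) V \/ all (fun v => r s v) V].
have step i : good \/ (2 * M < T - i ->
    (i = 0 \/ r (d * T) (d * (T - i))) /\ all (fun a => r a (d * (T - i))) A).
  elim: i => [|i [g|IH]]; [by right; rewrite subn0; split; [left|]|by left|].
  case: (ltnP (2 * M) (T - i.+1)) => [lt|ge]; last by right; lia.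
  have lt' : 2 * M < T - i by lia.
  have [IH1 IH2] := IH lt'.
  set y := d * (T - i) in IH1 IH2; set x := d * (T - i.+1).
  have yx : y = x + d by rewrite /y /x -mulnSr; congr (_ * _); lia.
  have xK : 2 * M < x by rewrite /x; nia.
  have yN : y <= N by apply: leq_trans dN; rewrite leq_mul2l; lia.
  have /orP[rxy|ryx] : r x y || r y x by apply: rtot; lia.
    left; exists (x :: A), y; split; rewrite /=.
    - rewrite uA andbT; apply/negP => /(allP bA) /andP[_].
      by rewrite leqNgt xK.
    - by rewrite sA.
    - apply/and3P; split; [lia | lia |].
      by apply/allP => a /(allP bA); nia.
    - by rewrite yx.
    - by left; rewrite rxy.
  right=> _; split; last first.
    by apply/allP => a /(allP IH2) ray; apply: rtr ray ryx.
  right; case: IH1 => [i0|h]; last exact: rtr h ryx.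
  by move: ryx; rewrite /y i0 subn0.
have above j : good \/ (2 * M < j < T -> r (d * T) (d * j)).
  case: (step (T - j)) => [g|h]; [by left|right=> /andP[j1 j2]].
  have e : T - (T - j) = j by lia.
  by move: h; rewrite e => /(_ j1) [[]]; lia.
pose J := rcons (iota (2 * M).+1 M) (T - sumn (iota (2 * M).+1 M)).
have JT : all (fun j => 2 * M < j < T) J.
  rewrite /width in WT; rewrite all_rcons; apply/andP; split.
    have : 0 < sumn (iota (2 * M).+1 M) by case: (M) M0 => //=; lia.
    by lia.
  by apply/allP => j; rewrite mem_iota; lia.
have [g|aJ] : good \/ all (fun j => r (d * T) (d * j)) J.
  elim: (J) JT => [|j s IH] /=; first by right.
  move=> /andP[hj /IH [g|->]]; first by left.
  by case: (above j) => [g|/(_ hj) ->]; [left|right].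
- exact: g.
exists (map (muln d) J), (d * T); split.
- rewrite map_inj_uniq; last by move=> x y /eqP; rewrite eqn_pmul2l // => /eqP.
  rewrite rcons_uniq iota_uniq andbT mem_iota /width in WT *; lia.
- by rewrite size_map size_rcons size_iota.
- rewrite /= dN andbT; apply/andP; split; first by rewrite muln_gt0 d0 /width in WT *; lia.
  apply/allP => x /mapP[j /(allP JT) hj ->]; rewrite muln_gt0 d0 /=.
  apply/andP; split; first lia.
  by apply: leq_trans dN; rewrite leq_mul2l; lia.
- rewrite sumn_map_mul sumn_rcons; congr (_ * _).
  rewrite /width in WT; lia.
- by right; rewrite all_map.
Qed.

Lemma unavoidable_exists (k : nat) : 3 <= k -> exists n, unavoidable k n.
Proof.
case: k => [|[|M]] // hk; have M0 : 0 < M by lia.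
pose B := M * (2 * M); pose n := (B * B * width M).-1.
have B0 : 0 < B by rewrite muln_gt0; lia.
have W0 : 0 < width M by [].
have nE : n.+1 = B * B * width M by rewrite /n prednK //; nia.
exists n.+1; rewrite /unavoidable /=; apply/forallP => p.
pose pos v : 'I_n.+1 := (p^-1)%g (inord v.-1).
have posK v : 0 < v <= n.+1 -> entry p (pos v) = v.
  move=> hv; rewrite /entry /pos permKV inordK; lia.
pose le := fun v w => pos v <= pos w.
pose lt := fun v w => pos v < pos w.
pose gt := fun v w => pos w < pos v.
have lt_tot x y : 0 < x <= n.+1 -> 0 < y <= n.+1 -> x != y -> lt x y || lt y x.
  move=> hx hy nxy; rewrite /lt -neq_ltn; apply: contra nxy => /eqP/val_inj e.
  by rewrite -(posK _ hx) e posK.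
pose S := sort le (iota 1 (2 * M)).
have leT : total le by move=> x y; apply: leq_total.
have le_tr : transitive le by move=> x y z; apply: leq_trans.
have Ss : sorted le S by apply: sort_sorted.
have Su : uniq S by rewrite sort_uniq iota_uniq.
have Sz : size S = 2 * M by rewrite size_sort size_iota.
have Sb : all (fun x => 0 < x <= 2 * M) S.
  by apply/allP => x; rewrite mem_sort mem_iota; lia.
pose A := take M S; pose C := drop M S.
have AC : S = A ++ C by rewrite cat_take_drop.
have sA : size A = M by rewrite size_take Sz; case: ifP; lia.
have sC : size C = M by rewrite size_drop Sz; lia.
move: Su; rewrite AC cat_uniq => /and3P[uA dAC uC].
move: Sb; rewrite AC all_cat => /andP[bA bC].
move: Ss; rewrite (sorted_pairwise le_tr) AC pairwise_cat => /and3P[rAC _ _].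
have sumB U : size U = M -> all (fun x => 0 < x <= 2 * M) U -> 0 < sumn U <= B.
  move=> sU bU; apply/andP; split.
    apply: leq_trans (sumn_ge (s := U) _); first by rewrite sU.
    by apply/allP => x /(allP bU) /andP[].
  rewrite /B -sU {2}sU; apply: sumn_le.
  by apply/allP => x /(allP bU) /andP[].
have dA := sumB A sA bA; have dC := sumB C sC bC.
pose s := sumn A * sumn C * width M.
have sN : s <= n.+1 by rewrite nE leq_mul2r; apply/orP; right; apply: leq_mul; lia.
have KW : 2 * M < width M by rewrite /width; lia.
have s2 : 2 * M < s.
  by apply: leq_trans KW _; rewrite leq_pmull // muln_gt0; lia.
have fin (V : seq nat) (t : nat) :
    [/\ uniq V, size V = M.+1, all (fun x => 0 < x <= n.+1) (t :: V), sumn V = t &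
        all (fun v => lt v t) V \/ all (fun v => lt t v) V] ->
    has_two_additive_subseq M.+2 p.
  move=> [uV sV /= /andP[bt bV] eV h].
  have uP : uniq (map pos V).
    rewrite map_inj_in_uniq // => x y /(allP bV) hx /(allP bV) hy e.
    by rewrite -(posK _ hx) e posK.
  have eP : sumn (map (entry p) (map pos V)) = entry p (pos t).
    rewrite posK // -eV -map_comp; congr sumn; rewrite -[RHS]map_id.
    by apply/eq_in_map => x /(allP bV) hx; rewrite /= posK.
  rewrite -sV -(size_map pos V); case: h => h.
    by apply: (has_left (j := pos t)) => //; rewrite all_map.
  by apply: (has_right (j := pos t)) => //; rewrite all_map.
have [hA|/allPn[a aA nas]] := boolP (all (fun a => lt a s) A).
  have [] := @descent lt n.+1 M A (sumn C * width M) _ lt_tot M0 uA sA bA.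
  - by move=> x y z; apply: ltn_trans.
  - by rewrite leq_pmull; lia.
  - by rewrite mulnA.
  - by rewrite mulnA.
  by move=> V [t h]; apply: (fin V t).
have hC : all (fun c => gt c s) C.
  apply/allP => c cC; rewrite /gt.
  have hc := allP bC _ cC; have ha := allP bA _ aA.
  have lac : le a c by apply: (allrelP rAC).
  have : lt c s || lt s c by apply: lt_tot; lia.
  move: nas lac; rewrite /lt /le; lia.
have gt_tr : transitive gt by move=> x y z; rewrite /gt => *; lia.
have gt_tot x y : 0 < x <= n.+1 -> 0 < y <= n.+1 -> x != y -> gt x y || gt y x.
  by move=> hx hy /(lt_tot _ _ hx hy); rewrite orbC.
have sE : s = sumn C * (sumn A * width M) by rewrite /s mulnCA mulnA.
have [] := @descent gt n.+1 M C (sumn A * width M) gt_tr gt_tot M0 uC sC bC.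
- by rewrite leq_pmull; lia.
- by rewrite -sE.
- by rewrite -sE.
move=> V [t [h1 h2 h3 h4 h5]]; apply: (fin V t); split=> //.
by case: h5; [right|left].
Qed.

(* f(k, 2); ex_minn returns the least witness. *)
Definition f2 (k : nat) (hk : 3 <= k) : nat := ex_minn (unavoidable_exists hk).

(* Main.v *)
Require Import Defs.
From mathcomp Require Import all_boot all_order all_algebra.
From mathcomp Require Import perm zify lra.

Import GRing.Theory Num.Theory.

(** Put m = k - 1. A 2-additive subsequence of length k is an entry v together
    with m other entries of sum v, lying either all to the left or all to the
    right of v. The bound (k - 1)(3k - 4) / 2 is the sum
    m + (m + 1) + ... + (2m - 1), the least sum of m distinct integers that
    are all at least m.

    For n below this bound, the permutation
      1, 2, ..., m - 1, n, n - 1, ..., m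
    has no such subsequence. A sum of m positive integers is at least m, so v
    is one of n, ..., m. To the right of v all entries are at least m, and m
    of them add up to more than n ([sum_distinct_ge]). To the left of v stand
    only m - 1 entries that are smaller than v, so any m entries taken there
    include one that exceeds v ([block_rev_left]). Hence no n below the bound
    is unavoidable. *)

(** The i-th term of an increasing sequence starting at a or later is at least
    a + i; twice the arithmetic sum avoids a halving. *)
Lemma sum_sorted_ge a s :
  sorted ltn s -> all (leq a) s -> size s * (2 * a + (size s).-1) <= 2 * sumn s.
Proof.
elim: s a => [|x s IH] a //=.
rewrite (path_sortedE ltn_trans) => /andP[gt_x srt_s] /andP[le_ax _].
have := IH x.+1 srt_s gt_x.
by case: (size s) => [|l] /=; nia.
Qed.

Lemma sum_distinct_ge a s :
  uniq s -> all (leq a) s -> size s * (2 * a + (size s).-1) <= 2 * sumn s.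
Proof.
move=> uniq_s ge_a; have perm_s : perm_eq (sort leq s) s by rewrite perm_sort.
rewrite -(perm_sumn perm_s) -(perm_size perm_s); apply: sum_sorted_ge.
  by rewrite ltn_sorted_uniq_leq sort_uniq uniq_s sort_sorted //; apply: leq_total.
by rewrite (perm_all _ perm_s).
Qed.

Lemma mem_leq_sumn x s : x \in s -> x <= sumn s.
Proof. by elim: s => //= y s IH; rewrite inE => /orP[/eqP ->|/IH]; lia. Qed.

Section BlockReversal.

Variables n h : nat.

Lemma block_rev_subproof (i : 'I_n) :
  (if i < h then i : nat else n + h - i.+1) < n.
Proof. by case: ifP; have := ltn_ord i; lia. Qed.

Definition block_rev_fun (i : 'I_n) : 'I_n := Ordinal (block_rev_subproof i).

Lemma block_rev_funK : involutive block_rev_fun.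
Proof.
move=> i; apply: val_inj => /=; have := ltn_ord i.
by case: (ltnP i h) => [-> //|ge_h]; case: ifP; lia.
Qed.

(** With h = m - 1, this is the permutation 1, ..., m - 1, n, ..., m; it is the
    identity when n <= h. *)
Definition block_rev : 'S_n := perm (inv_inj block_rev_funK).

Lemma entry_block_rev (i : 'I_n) :
  entry block_rev i = if i < h then i.+1 else n + h - i.
Proof. by rewrite /entry permE /=; have := ltn_ord i; case: ifP; lia. Qed.

Lemma entry_inj (p : 'S_n) : injective (entry p).
Proof. by move=> i j [] /val_inj /perm_inj. Qed.

Lemma entry_ge_size (p : 'S_n) (j : 'I_n) (U : seq 'I_n) :
  sumn (map (entry p) U) = entry p j -> size U <= entry p j.
Proof.
move=> <-; rewrite -(size_map (entry p)).
by apply: sumn_ge; apply/allP => _ /mapP[i _ ->].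
Qed.

(** An entry that is a sum of h + 1 entries is too large to stand at one of the
    first h positions, so everything to its right is at least h + 1. *)
Lemma block_rev_right (j : 'I_n) (U : seq 'I_n) :
  2 * n < h.+1 * (3 * h + 2) ->
  uniq U -> size U = h.+1 -> all (fun i : 'I_n => j < i) U ->
  sumn (map (entry block_rev) U) <> entry block_rev j.
Proof.
move=> small_n uniq_U size_U right_U sum_U.
have le_n : entry block_rev j <= n by rewrite /entry ltn_ord.
have := entry_ge_size _ _ _ sum_U.
rewrite size_U {1}entry_block_rev; case: (ltnP j h) => [|ge_j _]; first lia.
have ge_h1 : all (leq h.+1) (map (entry block_rev) U).
  apply/allP => _ /mapP[i /(allP right_U) lt_ji ->].
  by rewrite entry_block_rev; have := ltn_ord i; case: ifP; lia.
have := sum_distinct_ge h.+1 _ _ ge_h1.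
rewrite map_inj_uniq; last exact: entry_inj.
by rewrite uniq_U size_map size_U sum_U => /(_ isT); nia.
Qed.

(** By pigeonhole, h + 1 distinct positions cannot all lie among the first h;
    one of them is in the decreasing block and carries an entry that is
    already larger than the one at j. *)
Lemma block_rev_left (j : 'I_n) (U : seq 'I_n) :
  uniq U -> size U = h.+1 -> all (fun i : 'I_n => i < j) U ->
  sumn (map (entry block_rev) U) <> entry block_rev j.
Proof.
move=> uniq_U size_U left_U sum_U.
have := entry_ge_size _ _ _ sum_U.
rewrite size_U {1}entry_block_rev; case: (ltnP j h) => [|ge_j _]; first lia.
have [in_head|/allPn[i iU]] := boolP (all (fun i : 'I_n => i < h) U).
  have /uniq_leq_size : uniq (map val U) by rewrite map_inj_uniq //; apply: val_inj.
  move=> /(_ (iota 0 h)); rewrite size_map size_iota size_U.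
  suff sub : {subset map val U <= iota 0 h} by move=> /(_ sub); lia.
  by move=> _ /mapP[i /(allP in_head) lt_i ->]; rewrite mem_iota /=; lia.
rewrite -leqNgt => ge_i; have lt_ij := allP left_U _ iU.
have := mem_leq_sumn _ _ (map_f (entry block_rev) iU).
rewrite sum_U !entry_block_rev; have := ltn_ord j.
by do 2! case: ifP; lia.
Qed.

Lemma block_rev_avoids :
  2 * n < h.+1 * (3 * h + 2) -> ~~ has_two_additive_subseq h.+2 block_rev.
Proof.
move=> small_n; apply/existsP => -[t /andP[]]; move: (size_tuple t).
have lt_tr : transitive (fun i j : 'I_n => i < j) by move=> ? ? ?; apply: ltn_trans.
have lt_irr : irreflexive (fun i j : 'I_n => i < j) by move=> ?; apply: ltnn.
move: (tval t) => {t} s size_s srt_s.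
have uniq_s : uniq s := sorted_uniq lt_tr lt_irr srt_s.
case/orP => /eqP.
- case: s size_s srt_s uniq_s => [//|j U] /= [size_U] + /andP[_ uniq_U] sum_s.
  rewrite (path_sortedE lt_tr) => /andP[right_U _].
  by apply: (block_rev_right j U) => //; lia.
- case/lastP: s size_s srt_s uniq_s => [//|U j].
  rewrite size_rcons rcons_uniq => -[size_U] + /andP[_ uniq_U].
  rewrite (sorted_pairwise lt_tr) pairwise_rcons => /andP[left_U _].
  rewrite map_rcons sumn_rcons last_rcons => sum_s.
  by apply: (block_rev_left j U) => //; lia.
Qed.

End BlockReversal.

(** With k = h + 2, the bound (k - 1)(3k - 4) is (h + 1)(3h + 2), free of
    truncated subtraction. *)
Lemma unavoidable_ge (h n : nat) :
  unavoidable h.+2 n -> h.+1 * (3 * h + 2) <= 2 * n.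
Proof.
move=> /andP[_ /forallP unav]; rewrite leqNgt; apply/negP => small_n.
by have := block_rev_avoids n h small_n; rewrite unav.
Qed.

Local Open Scope ring_scope.

Theorem theorem3p4 (k : nat) (hk : (3 <= k)%N) :
  (k%:R - 1) * (3 * k%:R - 4) / 2 <= (f2 hk)%:R :> rat.
Proof.
rewrite /f2; case: ex_minnP => n unav _.
case: k hk unav => [|[|h]] // hk /unavoidable_ge.
rewrite -(ler_nat rat) !natrM natrD natrM -!natr1 => ge_n.
rewrite ler_pdivrMr //; lra.
Qed.
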